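(* Let $F$ be a T-nondegenerate form. Then $\mathfrak g_3=0$.
   Context: $F=(F_1,\dots,F_k)$ is a $\mathbb C^k$-valued Hermitian form on $\mathbb C^m$: $F_j(a,b)=\langle A_ja,b\rangle$, $\langle a,b\rangle=\sum_l a_l\bar b_l$, with $A_1,\dots,A_k$ Hermitian $m\times m$ matrices. $F$ is nondegenerate if (a) $A_1,\dots,A_k$ are linearly independent and (b) $F(z,\zeta)=0$ for all $z\in\mathbb C^m$ implies $\zeta=0$. For a set $S\subset\mathbb C^m$ put $S^F=\{x\in\mathbb C^m:\ F(x,y)=0\ \ \forall y\in S\}$. For $a\in\mathbb C^m$ put $T(a)=\{y\in\mathbb C^m:\ \exists x\in\mathbb C^m,\ F(x,a)+F(a,y)=0\}$. A property holds for generic $a\in\mathbb C^m$ if it holds for all $a$ in some open dense subset of $\mathbb C^m$. A nondegenerate form $F$ is T-nondegenerate if $T(a)^F=0$ for generic $a\in\mathbb C^m$. With coordinates $z\in\mathbb C^m$, $w=u+iv\in\mathbb C^k$, $\mathfrak g=\sum_{p\ge-2}\mathfrak g_p$ is the graded Lie algebra of infinitesimal CR automorphisms of the quadric $v=F(z,z)$; its elements are polynomial vector fields $f\frac{\partial}{\partial z}+g\frac{\partial}{\partial w}=:(f,g)$ with $f,g$ holomorphic polynomials in $(z,w)$ satisfying $\operatorname{Im}(g-2iF(f,z))=0$ on the quadric. Giving $z_j,w_j,\partial/\partial z_j,\partial/\partial w_j$ weights $1,2,-1,-2$, $\mathfrak g_p$ is the subspace of weighted homogeneous elements of degree $p$,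 i.e. the space of pairs $(f,g)$ of weighted homogeneous holomorphic polynomial maps $f$ ($\mathbb C^m$-valued, weighted degree $p+1$) and $g$ ($\mathbb C^k$-valued, weighted degree $p+2$) with $\operatorname{Im}(g-2iF(f,z))|_{w=u+iF(z,z)}=0$ for all $z\in\mathbb C^m$, $u\in\mathbb R^k$. In particular, $\mathfrak g_3$ is the case $p=3$. *)

(* Defs.v *)
From mathcomp Require Import all_boot all_order all_algebra.
From mathcomp Require Import all_classical all_reals all_analysis.
From mathcomp.real_closed Require Import complex.
(* Its notations clash with those of mathcomp-analysis. *)
From mathcomp.multinomials Require Import -(notations) mpoly.

Set Implicit Arguments.
Unset Strict Implicit.
Unset Printing Implicit Defensive.

Import Order.TTheory GRing.Theory Num.Theory.
Import numFieldNormedType.Exports.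

Local Open Scope classical_set_scope.
Local Open Scope ring_scope.

(* R[i] is named as a structure so that 'cV[cplx R]_m gets the topology that
   mathcomp-analysis puts on numeric fields; R[i] itself has none. *)
Definition cplx (R : realType) : numClosedFieldType := R[i].

Section HermitianForm.
Variables (R : realType) (m k : nat).
Notation C := (cplx R).

Definition herm_dot (a b : 'cV[C]_m) : C := \sum_l a l 0 * (b l 0)^*.

Variable A : 'I_k -> 'M[C]_m.

Definition hform (a b : 'cV[C]_m) : 'cV[C]_k := \col_j herm_dot (A j *m a) b.

(* Over C; for Hermitian matrices this agrees with independence over R. *)
Definition nondegenerate_form : Prop :=
  free [tuple A j | j < k] /\
  (forall zeta, (forall z, hform z zeta = 0) -> zeta = 0).

Definition form_orth (S : set 'cV[C]_m) : set 'cV[C]_m :=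
  [set x | forall y, S y -> hform x y = 0].

Definition form_T (a : 'cV[C]_m) : set 'cV[C]_m :=
  [set y | exists x, hform x a + hform a y = 0].

Definition generic (P : set 'cV[C]_m) : Prop :=
  exists U : set 'cV[C]_m, [/\ open U, dense U & U `<=` P].

Definition T_nondegenerate : Prop :=
  nondegenerate_form /\ generic [set a | form_orth (form_T a) = [set 0]].

(* Of the m + k variables, the first m are z and the last k are w. *)
Notation mpolyC := (mpoly (m + k) C).

Definition mon_weight (mu : multinom (m + k)) : nat :=
  (\sum_(i < m) mu (lshift k i) + 2 * \sum_(j < k) mu (rshift m j))%N.

(* d : int, since f and g have negative degree in some g_p; only 0 is then
   homogeneous. *)
Definition whomog (d : int) (p : mpolyC) : Prop :=
  forall mu, mu \in msupp p -> (mon_weight mu)%:Z = d.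

Definition poly_eval n (h : 'cV[mpolyC]_n) (z : 'cV[C]_m) (w : 'cV[C]_k) :
    'cV[C]_n :=
  \col_l meval (fun i => col_mx z w i 0) (h l 0).

Definition quadric_w (z : 'cV[C]_m) (u : 'cV[R]_k) : 'cV[C]_k :=
  map_mx (real_complex R) u + 'i *: hform z z.

Definition quadric_aut (f : 'cV[mpolyC]_m) (g : 'cV[mpolyC]_k) : Prop :=
  forall (z : 'cV[C]_m) (u : 'cV[R]_k) (j : 'I_k),
    let w := quadric_w z u in
    'Im ((poly_eval g z w - (2 * 'i) *: hform (poly_eval f z w) z) j 0) = 0.

Definition aut_comp (p : int) : set ('cV[mpolyC]_m * 'cV[mpolyC]_k) :=
  [set fg : 'cV[mpolyC]_m * 'cV[mpolyC]_k |
    [/\ forall l, whomog (p + 1) (fg.1 l 0),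
        forall j, whomog (p + 2) (fg.2 j 0)
      & quadric_aut fg.1 fg.2]].

End HermitianForm.

(* Main.v *)
Require Import Defs.
From mathcomp Require Import all_boot all_order all_algebra.
From mathcomp Require Import all_classical all_reals all_analysis.
From mathcomp.real_closed Require Import complex.
From mathcomp.multinomials Require Import -(notations) mpoly.
From mathcomp Require Import ring.

(** Write F for the form and let (f, g) be an element of g_3. The defining
    equation holds on the totally real set where the conjugate variable is
    the conjugate of z, so it extends to an identity in which that variable is
    replaced by an independent zeta ([quadric_aut_polarized]). At zeta = 0 it
    gives g(z, w) = 2i F(z, h(conj w)) with h(w) = f(0, w). As h is quadratic,
    h(w) = K(w, w) for a symmetric bilinear K, and comparing degrees in zeta
    leaves two facts, for all z, zeta, w:
    - [aut3_linear]: F(f(z, w) - h(w), zeta) = 4i F(z, K(conj w, F(zeta, z)));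
    - [aut3_cubic]: F(z, K(F(zeta, z), F(zeta, z))) = 0.
    The first one shows, by nondegeneracy, that (f, g) vanishes once K does.

    T-nondegeneracy enters in order to prove K = 0. Let a be generic, so that
    T(a) has no nonzero vector F-orthogonal to it, and put s = F(a, a). For y in
    T(a), with witness x, the relation F(a, y) = - F(x, a) allows to replace a
    second argument y by a first argument x. Polarizing the cubic identity in
    direction y then gives F(y, K(s, s)) = 0, hence K(s, s) = 0
    ([qmap_diag0]). This identity extends from generic a to all of them and
    polarizes to K(F(z, zeta), F(z, zeta)) = 0 ([qmap_square0]), which makes
    K(F(p, x), F(q, y)) alternate both in (p, q) and in (x, y). The same
    replacement now gives K(s, F(zeta, y)) = 0 and K(s, F(y, z)) = 0 for y in
    T(a) ([qmap_form_T], [qmap_form_T_left]).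

    Finally consider the polarization B of f(., s) - h(s) at (z, y), with z
    arbitrary and y in T(a). By the linear identity, F(B, zeta) is a multiple of
    F(z, K(s, F(zeta, y))) + F(y, K(s, F(zeta, z))). The first term is 0, and
    for zeta in T(a) so is the second; hence B = 0. Therefore
    F(y, K(s, F(zeta, z))) = 0 for all y in T(a), which means
    K(s, F(zeta, z)) = 0 ([qmap_generic0]). The values of F span because the
    matrices A_j are independent, so K = 0 ([qmap_eq0]). *)

Set Implicit Arguments.
Unset Strict Implicit.
Unset Printing Implicit Defensive.

Import Order.TTheory GRing.Theory Num.Theory.
Import numFieldNormedType.Exports.

Local Open Scope classical_set_scope.
Local Open Scope ring_scope.

(** * Polynomial functions of one and several variables *)

Section PolynomialFunctions.
Variable C : numClosedFieldType.
Implicit Types (phi psi : C -> C) (t : C).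

Definition polyfun phi := exists p : {poly C}, forall t, phi t = p.[t].

Lemma polyfun_cst c : polyfun (fun=> c).
Proof. by exists c%:P => t; rewrite hornerC. Qed.

Lemma polyfun_id : polyfun id.
Proof. by exists 'X => t; rewrite hornerX. Qed.

Lemma polyfunD phi psi :
  polyfun phi -> polyfun psi -> polyfun (fun t => phi t + psi t).
Proof. by move=> [p hp] [q hq]; exists (p + q) => t; rewrite hornerD hp hq. Qed.

Lemma polyfunM phi psi :
  polyfun phi -> polyfun psi -> polyfun (fun t => phi t * psi t).
Proof. by move=> [p hp] [q hq]; exists (p * q) => t; rewrite hornerM hp hq. Qed.

Lemma polyfunN phi : polyfun phi -> polyfun (fun t => - phi t).
Proof. by move=> [p hp]; exists (- p) => t; rewrite hornerN hp. Qed.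

Lemma polyfunX phi n : polyfun phi -> polyfun (fun t => phi t ^+ n).
Proof. by move=> [p hp]; exists (p ^+ n) => t; rewrite horner_exp hp. Qed.

Lemma polyfun_sum (I : Type) (r : seq I) (F : I -> C -> C) :
  (forall i, polyfun (F i)) -> polyfun (fun t => \sum_(i <- r) F i t).
Proof.
move=> hF; elim: r => [|i r [p hp]].
  by exists 0 => t; rewrite big_nil horner0.
have [q hq] := hF i.
by exists (q + p) => t; rewrite big_cons hornerD hp hq.
Qed.

Lemma polyfun_prod (I : Type) (r : seq I) (F : I -> C -> C) :
  (forall i, polyfun (F i)) -> polyfun (fun t => \prod_(i <- r) F i t).
Proof.
move=> hF; elim: r => [|i r [p hp]].
  by exists 1 => t; rewrite big_nil hornerC.
have [q hq] := hF i.
by exists (q * p) => t; rewrite big_cons hornerM hp hq.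
Qed.

(** This is how complex conjugates are continued holomorphically: at a real t the
    function is simply the conjugate of phi t. *)
Lemma polyfun_conj phi : polyfun phi -> polyfun (fun t => (phi t^*)^*).
Proof.
move=> [p hp]; exists (map_poly Num.conj p) => t.
by rewrite hp -[t in RHS]conjCK horner_map.
Qed.

Lemma polyfun_meval n (p : mpoly n C) (v : C -> 'I_n -> C) :
  (forall i, polyfun (fun t => v t i)) -> polyfun (fun t => meval (v t) p).
Proof.
move=> hv.
have [q hq] : polyfun (fun t =>
    \sum_(mu <- msupp p) mcoeff mu p * \prod_i v t i ^+ mu i).
  apply: polyfun_sum => mu; apply: polyfunM; first exact: polyfun_cst.
  by apply: polyfun_prod => i; apply: polyfunX.
by exists q => t; rewrite mevalE hq.
Qed.

Lemma poly_eq0_nat (p : {poly C}) : (forall n : nat, p.[n%:R] = 0) -> p = 0.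
Proof.
move=> hp; apply: contraTeq isT => p_neq0 /=.
have := max_poly_roots p_neq0 (rs := [seq n%:R | n <- iota 0 (size p)]).
rewrite size_map size_iota ltnn; apply.
  by apply/allP => _ /mapP[n _ ->]; apply/eqP/hp.
by rewrite map_inj_uniq ?iota_uniq //; apply: mulrIn; rewrite oner_eq0.
Qed.

(** The natural numbers are real and infinite in number: an identity known at
    real parameters can be continued to complex ones by checking it there. *)
Lemma polyfun_eq0 phi :
  polyfun phi -> (forall n : nat, phi n%:R = 0) -> forall t, phi t = 0.
Proof.
move=> [p hp] h0 t; rewrite hp (@poly_eq0_nat p) ?horner0 // => n.
by rewrite -hp h0.
Qed.

(** The two sides of the hypothesis are polynomials in n, of which the left one
    has only a linear term and the right one none. *)
Lemma polyfun_order2 c (rho : C -> C) : polyfun rho ->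
  (forall n : nat, n%:R * c = n%:R ^+ 2 * rho n%:R) -> c = 0.
Proof.
move=> [p hp] h.
have h0 : 'X * (c%:P - 'X * p) = 0 :> {poly C}.
  apply: poly_eq0_nat => n; rewrite !hornerE -hp mulrBr h; ring.
have /eqP := h0; rewrite mulf_eq0 polyX_eq0 /= => /eqP /(congr1 (horner^~ 0)).
by rewrite !hornerE subr0.
Qed.

(** Scaling a single variable by a parameter t separates the monomials by their
    degree in that variable; once this is done for every variable, only one
    monomial is left. *)
Lemma meval_eq0 n (p : mpoly n C) : (forall v, meval v p = 0) -> p = 0.
Proof.
move=> hp.
have sep (s : seq 'I_n) (nu : 'I_n -> nat) (v : 'I_n -> C) :
    \sum_(mu <- msupp p | all (fun i => mu i == nu i) s)
       mcoeff mu p * \prod_i v i ^+ mu i = 0.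
  elim: s v => [|i s IHs] v; first by rewrite -[RHS](hp v) mevalE.
  pose c mu := mcoeff mu p * \prod_j v j ^+ mu j.
  pose P := \sum_(mu <- msupp p | all (fun j => mu j == nu j) s)
     c mu *: 'X^(mu i).
  have P0 : P = 0.
    apply: poly_eq0_nat => a.
    rewrite -[RHS](IHs (fun j => if j == i then a%:R * v j else v j)).
    rewrite horner_sum; apply: eq_bigr => mu _.
    rewrite hornerZ hornerXn /c -mulrA; congr (_ * _).
    rewrite [in RHS](bigD1 i) //= eqxx exprMn [in LHS](bigD1 i) //=.
    rewrite [LHS]mulrC mulrA; congr (_ * _).
    by apply: eq_bigr => j /negbTE ->.
  have := congr1 (fun q : {poly C} => q`_(nu i)) P0.
  rewrite coef0 coef_sum => {2}<-; rewrite [RHS]big_mkcond [LHS]big_mkcond /=.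
  apply: eq_bigr => mu _; rewrite coefZ coefXn eq_sym /=.
  by case: (_ == _); case: (all _ _); rewrite /= ?mulr1 ?mulr0.
apply/mpolyP => nu; rewrite mcoeff0.
have [hnu|/memN_msupp_eq0 //] := boolP (nu \in msupp p).
have := sep (enum 'I_n) nu (fun=> 1).
rewrite (eq_bigl (fun mu => mu == nu)) => [|mu].
  rewrite -big_filter filter_pred1_uniq ?msupp_uniq // big_seq1.
  by rewrite big1 ?mulr1 // => i _; rewrite expr1n.
apply/allP/eqP => [h|-> //].
by apply/mnmP => i; apply/eqP/h; rewrite mem_enum.
Qed.

(** Unlike [mxE], these rules leave the coordinates of all other vectors, such as
    the values of a form, folded. *)
Lemma coordD n (u v : 'cV[C]_n) i : (u + v) i 0 = u i 0 + v i 0.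
Proof. by rewrite mxE. Qed.

Lemma coordN n (u : 'cV[C]_n) i : (- u) i 0 = - u i 0.
Proof. by rewrite mxE. Qed.

Lemma coordZ n c (u : 'cV[C]_n) i : (c *: u) i 0 = c * u i 0.
Proof. by rewrite mxE. Qed.

Definition coordE := (coordD, coordN, coordZ).

Lemma polyfun_line n (a b : 'cV[C]_n) l :
  polyfun (fun t => (a + t *: b) l 0).
Proof.
have [p hp] := polyfunD (polyfun_cst (a l 0))
  (polyfunM polyfun_id (polyfun_cst (b l 0))).
by exists p => t; rewrite -hp !mxE.
Qed.

End PolynomialFunctions.

(** * Weighted homogeneous polynomials *)

Section WeightedMonomials.
Variables (C : numClosedFieldType) (m k : nat).
Implicit Types (mu : multinom (m + k)) (p : mpoly (m + k) C).
Implicit Types (z : 'cV[C]_m) (w : 'cV[C]_k).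

Definition mev p z w := meval (fun i => col_mx z w i 0) p.
Definition zdeg mu := (\sum_(i < m) mu (lshift k i))%N.
Definition wdeg mu := (\sum_(j < k) mu (rshift m j))%N.
Definition zmon mu z := \prod_(i < m) z i 0 ^+ mu (lshift k i).
Definition wmon mu w := \prod_(j < k) w j 0 ^+ mu (rshift m j).

Lemma mevE p z w :
  mev p z w = \sum_(mu <- msupp p) mcoeff mu p * (zmon mu z * wmon mu w).
Proof.
rewrite /mev mevalE; apply: eq_bigr => mu _; congr (_ * _).
rewrite big_split_ord /=; congr (_ * _); apply: eq_bigr => i _.
  by rewrite col_mxEu.
by rewrite col_mxEd.
Qed.

Lemma zmonZ mu t z : zmon mu (t *: z) = t ^+ zdeg mu * zmon mu z.
Proof.
rewrite /zmon /zdeg -prodrXr -big_split /=; apply: eq_bigr => i _.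
by rewrite mxE exprMn.
Qed.

Lemma zmon_zdeg0 mu z : zdeg mu = 0%N -> zmon mu z = 1.
Proof.
move/eqP; rewrite sum_nat_eq0 => /forallP h.
by rewrite /zmon big1 // => i _; move/eqP: (h i) => ->; rewrite expr0.
Qed.

Lemma zmon0 mu : zdeg mu != 0%N -> zmon mu 0 = 0.
Proof.
move=> h; have := zmonZ mu 0 0.
by rewrite scale0r expr0n (negbTE h) mul0r.
Qed.

Lemma mev_odd p w :
  (forall mu, mu \in msupp p -> odd (mon_weight mu)) -> mev p 0 w = 0.
Proof.
move=> hp; rewrite mevE big_seq big1 // => mu /hp hmu.
rewrite zmon0 ?mul0r ?mulr0 //; apply: contraTneq hmu => h.
by rewrite /mon_weight -/(zdeg mu) h add0n mul2n odd_double.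
Qed.

(** In a monomial of even weight the degree in z is even, so beyond the part
    independent of z there are only terms of order at least two in z. *)
Lemma mev_even_line p z w w' :
  (forall mu, mu \in msupp p -> ~~ odd (mon_weight mu)) ->
  exists2 r, polyfun r &
    forall t, mev p (t *: z) (w + t *: w') =
              mev p 0 (w + t *: w') + t ^+ 2 * r t.
Proof.
move=> hp.
pose r mu t := mcoeff mu p * (if zdeg mu == 0%N then 0 else
  t ^+ (zdeg mu - 2) * zmon mu z * wmon mu (w + t *: w')).
exists (fun t => \sum_(mu <- msupp p) r mu t).
  apply: polyfun_sum => mu; apply: polyfunM; first exact: polyfun_cst.
  case: eqP => _; first exact: polyfun_cst.
  apply: polyfunM; last first.
    apply: polyfun_prod => j; apply: polyfunX.
    have [q hq] := polyfunD (polyfun_cst (w j 0))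
      (polyfunM (polyfun_id C) (polyfun_cst (w' j 0))).
    by exists q => t; rewrite -hq !mxE.
  by apply: polyfunM; [exact/polyfunX/polyfun_id | exact: polyfun_cst].
move=> t; rewrite !mevE mulr_sumr -big_split /= big_seq [RHS]big_seq.
apply: eq_bigr => mu /hp hmu; rewrite /r.
have [h0|h0] := eqVneq (zdeg mu) 0%N.
  by rewrite !zmon_zdeg0 // !mulr0 addr0.
have h2 : (2 <= zdeg mu)%N.
  case E : (zdeg mu) h0 hmu => [|[|d]] // _.
  by rewrite /mon_weight -/(zdeg mu) E oddD mul2n odd_double.
rewrite zmonZ zmon0 // -{1}(subnK h2) exprD; ring.
Qed.

Lemma wmon_deg2 mu : wdeg mu = 2%N ->
  exists i j, forall w, wmon mu w = w i 0 * w j 0.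
Proof.
move=> h; pose e (j : 'I_k) := mu (rshift m j).
have [i ei] : exists i, e i != 0%N.
  apply/existsP; apply: contraPT h => /existsPn h.
  by rewrite /wdeg big1 // => i _; apply/eqP; have := h i; rewrite negbK.
(* The exponents of the monomial divided by its factor w_i. *)
pose e' j := (e j - (j == i))%N.
have ee' j : e j = ((j == i) + e' j)%N.
  by rewrite subnKC //; case: eqP => // ->; rewrite lt0n.
have h' : (\sum_j e' j = 1)%N.
  apply/eqP; rewrite -(eqn_add2l 1) -[X in X == _]/(1 + _)%N.
  move: h; rewrite /wdeg (eq_bigr _ (fun j _ => ee' j)) big_split /=.
  by rewrite (bigD1 i) //= eqxx big1 ?addn0 => [->|j /negbTE ->].
have [j ej] : exists j, e' j != 0%N.
  apply/existsP; apply: contraPT h' => /existsPn h'.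
  by rewrite big1 // => l _; apply/eqP; have := h' l; rewrite negbK.
have e'E l : e' l = (l == j).
  move: h'; rewrite (bigD1 j) //=; case E: (e' j) ej => [|d] // _.
  rewrite addSn => -[/eqP]; rewrite addn_eq0 => /andP[/eqP d0].
  rewrite sum_nat_eq0 => /forallP hl; case: (eqVneq l j) => [->|hlj].
    by rewrite E d0.
  by have := hl l; rewrite hlj /= => /eqP.
exists i, j => w; rewrite /wmon.
rewrite (eq_bigr (fun l => w l 0 ^+ (l == i) * w l 0 ^+ (l == j))); last first.
  by move=> l _; rewrite -exprD -e'E -ee'.
rewrite big_split /=; congr (_ * _).
  by rewrite (bigD1 i) //= eqxx big1 ?mulr1 // => l /negbTE ->.
by rewrite (bigD1 j) //= eqxx big1 ?mulr1 // => l /negbTE ->.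
Qed.

Definition qform (M : 'M[C]_k) (u v : 'cV[C]_k) :=
  \sum_i \sum_j u i 0 * M i j * v j 0.

(** A monomial of weight 4 free of z has degree 2 in w: on z = 0 the polynomial
    is a quadratic form. *)
Lemma mev_weight4 p :
  (forall mu, mu \in msupp p -> mon_weight mu = 4%N) ->
  exists2 M : 'M[C]_k, M^T = M & forall w, mev p 0 w = qform M w w.
Proof.
move=> hp.
suff [M hM] : exists M : 'M[C]_k, forall w, mev p 0 w = qform M w w.
  exists (2^-1 *: (M + M^T)); first by rewrite linearZ linearD /= trmxK addrC.
  move=> w; rewrite hM.
  suff E : qform M w w = qform M^T w w.
    transitivity (2^-1 * (qform M w w + qform M^T w w)).
      by rewrite -E; field.
    rewrite /qform -big_split /= mulr_sumr.
    apply: eq_bigr => i _; rewrite -big_split /= mulr_sumr.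
    by apply: eq_bigr => j _; rewrite !mxE; ring.
  rewrite /qform exchange_big /=; apply: eq_bigr => i _; apply: eq_bigr => j _.
  by rewrite mxE; ring.
suff [M hM] : exists M : 'M[C]_k, forall w,
    \sum_(mu <- msupp p) mcoeff mu p * (zmon mu 0 * wmon mu w) = qform M w w.
  by exists M => w; rewrite mevE.
elim: (msupp p) hp => [|mu s IHs] hs.
  exists 0 => w; rewrite big_nil /qform big1 // => i _; rewrite big1 // => j _.
  by rewrite mxE mulr0 mul0r.
have [|M hM] := IHs => [nu hnu|]; first by apply: hs; rewrite inE hnu orbT.
have [M' hM'] : exists M' : 'M[C]_k, forall w,
    mcoeff mu p * (zmon mu 0 * wmon mu w) = qform M' w w.
  have [h0|h0] := eqVneq (zdeg mu) 0%N; last first.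
    exists 0 => w; rewrite zmon0 // mul0r mulr0 /qform big1 // => i _.
    by rewrite big1 // => j _; rewrite mxE mulr0 mul0r.
  have h2 : wdeg mu = 2%N.
    have := hs mu (mem_head _ _); rewrite /mon_weight -/(zdeg mu) h0 add0n.
    rewrite -/(wdeg mu) (_ : 4 = 2 * 2)%N // => /eqP.
    by rewrite eqn_mul2l => /eqP.
  have [i [j hij]] := wmon_deg2 h2.
  exists (mcoeff mu p *: delta_mx i j) => w; rewrite zmon_zdeg0 // mul1r hij.
  rewrite /qform (bigD1 i) //= [X in _ = _ + X]big1 => [|l hl]; last first.
    by rewrite big1 // => l' _; rewrite !mxE (negbTE hl) /=; ring.
  rewrite (bigD1 j) //= [X in _ = _ + X + _]big1 => [|l hl]; last first.
    by rewrite !mxE (negbTE hl) andbF /=; ring.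
  by rewrite !mxE !eqxx /=; ring.
exists (M' + M) => w; rewrite big_cons hM hM' /qform -big_split /=.
apply: eq_bigr => i _; rewrite -big_split /=; apply: eq_bigr => j _.
by rewrite mxE; ring.
Qed.

End WeightedMonomials.

(** * Vanishing on a dense set *)

Section Density.
Variables (C : numClosedFieldType) (T : topologicalType).
Implicit Types phi psi : T -> C.

Lemma continuous_conjC : continuous (Num.conj : C -> C).
Proof.
move=> x; apply/(@cvgrPdist_lt _ C _ (nbhs x) (nbhs_filter x)) => e e0.
have /(@cvgrPdist_lt _ C _ (nbhs x) (nbhs_filter x)) /(_ e e0) :
  id y @[y --> x] --> x by exact: cvg_id.
by apply: filterS => y; rewrite -rmorphB norm_conjC.
Qed.

Lemma continuous_bigsum (I : Type) (r : seq I) (F : I -> T -> C) :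
  (forall i, continuous (F i)) -> continuous (fun a => \sum_(i <- r) F i a).
Proof.
move=> hF x; elim: r => [|i r IHr].
  rewrite (_ : (fun a => _) = (fun=> 0)); first exact: cvg_cst.
  by apply/funext => a; rewrite big_nil.
rewrite (_ : (fun a => _) = F i \+ (fun a => \sum_(j <- r) F j a)).
  by apply: cvgD; [exact: hF | exact: IHr].
by apply/funext => a; rewrite big_cons.
Qed.

Lemma dense_eq0 (U : set T) phi : dense U -> continuous phi ->
  (forall a, U a -> phi a = 0) -> forall a, phi a = 0.
Proof.
move=> dU cphi h0 a; apply: contrapT => ha.
have [] := dU (phi @^-1` (~` [set 0])).
- by exists a.
- apply: open_comp => [x _|]; first exact: cphi.
  apply: closed_openC; apply: accessible_closed_set1.
  by apply: hausdorff_accessible; exact: norm_hausdorff.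
- by move=> x [hx /h0].
Qed.

End Density.

(** * Vector-valued Hermitian forms *)

Section HermitianForms.
Variables (R : realType) (m k : nat).
Notation C := (cplx R).
Variable A : 'I_k -> 'M[C]_m.
Notation F := (hform A).
Notation cj := (map_mx Num.conj).
Implicit Types (a b : 'cV[C]_m) (c : C).

Lemma hformE a b j : F a b j 0 = \sum_l (\sum_q A j l q * a q 0) * (b l 0)^*.
Proof. by rewrite mxE; apply: eq_bigr => l _; rewrite mxE. Qed.

Lemma hformDl a a' b : F (a + a') b = F a b + F a' b.
Proof.
apply/colP => j; rewrite !mxE /herm_dot -big_split /=; apply: eq_bigr => l _.
by rewrite mulmxDr mxE mulrDl.
Qed.

Lemma hformDr a b b' : F a (b + b') = F a b + F a b'.
Proof.
apply/colP => j; rewrite !mxE /herm_dot -big_split /=; apply: eq_bigr => l _.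
by rewrite [(b + b') _ _]mxE rmorphD mulrDr.
Qed.

Lemma hformZl c a b : F (c *: a) b = c *: F a b.
Proof.
apply/colP => j; rewrite !mxE /herm_dot mulr_sumr; apply: eq_bigr => l _.
by rewrite -scalemxAr mxE mulrA.
Qed.

Lemma hformZr c a b : F a (c *: b) = c^* *: F a b.
Proof.
apply/colP => j; rewrite !mxE /herm_dot mulr_sumr; apply: eq_bigr => l _.
by rewrite [(c *: b) _ _]mxE rmorphM mulrCA.
Qed.

Lemma hform0l b : F 0 b = 0.
Proof. by rewrite -(scale0r 0) hformZl scale0r. Qed.

Lemma hform0r a : F a 0 = 0.
Proof. by rewrite -(scale0r 0) hformZr rmorph0 scale0r. Qed.

Lemma hformNl a b : F (- a) b = - F a b.
Proof. by rewrite -scaleN1r hformZl scaleN1r. Qed.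

Lemma hformNr a b : F a (- b) = - F a b.
Proof. by rewrite -scaleN1r hformZr rmorphN1 scaleN1r. Qed.

Lemma hform_conj a b : (forall j, A j \is hermsymmx) -> cj (F a b) = F b a.
Proof.
move=> hA; apply/colP => j; rewrite mxE !hformE rmorph_sum /=.
under eq_bigr => l _ do rewrite mulr_suml rmorph_sum.
under [RHS]eq_bigr => l _ do rewrite mulr_suml.
rewrite exchange_big; apply: eq_bigr => l _; apply: eq_bigr => q _ /=.
have := hA j; rewrite is_hermitianmxE => /eqP /matrixP /(_ l q).
rewrite expr0 scale1r !mxE => ->.
by rewrite !rmorphM /= conjCK; ring.
Qed.

(** The values of the form span: they are not all on one hyperplane, because the
    coefficients of a linear relation between them would be the coefficients of
    a linear relation between the matrices. *)
Lemma nondegenerate_span (c : 'I_k -> C) : nondegenerate_form A ->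
  (forall a b, \sum_j c j * F a b j 0 = 0) -> forall j, c j = 0.
Proof.
move=> [/freeP fA _] h; apply: fA; apply/matrixP => p q; rewrite summxE mxE.
rewrite -[RHS](h (delta_mx q 0) (delta_mx p 0)); apply: eq_bigr => j _.
rewrite (nth_map j) ?size_enum_ord // nth_ord_enum !mxE; congr (_ * _).
rewrite /herm_dot (bigD1 p) //= [X in _ + X]big1 => [|l /negbTE hl].
  by rewrite -colE !mxE !eqxx rmorph1 mulr1 addr0.
by rewrite [(delta_mx _ _) _ _]mxE hl rmorph0 mulr0.
Qed.

(** The form is antilinear in its second argument, hence the conjugated
    coordinates in the hypothesis on b. *)
Lemma polyfun_hform (a b : C -> 'cV[C]_m) :
  (forall l, polyfun (fun t => a t l 0)) ->
  (forall l, polyfun (fun t => (b t l 0)^*)) ->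
  forall j, polyfun (fun t => F (a t) (b t) j 0).
Proof.
move=> ha hb j.
have [p hp] : polyfun (fun t =>
    \sum_l (\sum_q A j l q * a t q 0) * (b t l 0)^*).
  apply: polyfun_sum => l; apply: polyfunM => //; apply: polyfun_sum => q.
  by apply: polyfunM => //; exact: polyfun_cst.
by exists p => t; rewrite hformE hp.
Qed.

Lemma continuous_hform_diag j : continuous (fun a => F a a j 0).
Proof.
rewrite (_ : (fun a => _) =
  (fun a => \sum_l \sum_q A j l q * (a q 0 * (a l 0)^*))).
  apply: continuous_bigsum => l; apply: continuous_bigsum => q x.
  apply: (@cvgM C _ (nbhs x) _ (fun=> A j l q)
    (fun a : 'cV[C]_m => a q 0 * (a l 0)^*)); first exact: cvg_cst.
  apply: (@cvgM C _ (nbhs x) _ (fun a : 'cV[C]_m => a q 0)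
    (fun a : 'cV[C]_m => (a l 0)^*)); first exact: coord_continuous.
  apply: (@continuous_comp _ _ _ (fun a : 'cV[C]_m => a l 0) Num.conj).
    exact: coord_continuous.
  exact: continuous_conjC.
apply/funext => a; rewrite hformE; apply: eq_bigr => l _.
by rewrite mulr_suml; apply: eq_bigr => q _; rewrite mulrA.
Qed.

End HermitianForms.

(** * Polarization *)

Section Polarization.
Variable C : numClosedFieldType.

Lemma alternating_antisym (V : zmodType) (B : V -> V -> C) :
  (forall x y z, B (x + y) z = B x z + B y z) ->
  (forall x y z, B x (y + z) = B x y + B x z) ->
  (forall x, B x x = 0) -> forall x y, B x y + B y x = 0.
Proof.
move=> Dl Dr B0 x y.
by have := B0 (x + y); rewrite Dl !Dr !B0 add0r addr0.
Qed.

Lemma symmetric_alternating0 (V : zmodType) (B : V -> V -> C) :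
  (forall x y z, B (x + y) z = B x z + B y z) ->
  (forall x y, B x y = B y x) ->
  (forall x, B x x = 0) -> forall x y, B x y = 0.
Proof.
move=> Dl S B0 x y; have := alternating_antisym Dl _ B0 x y.
rewrite -(S x y) -mulr2n => h; apply/eqP; rewrite -[_ == _](@mulrn_eq0 _ _ 2).
by rewrite h // => u v w; rewrite S Dl ![B _ u]S.
Qed.

(** The left-hand side is the part of T(a + y, a + y, a + y) linear in y. Doubling
    y multiplies it by 2 and the quadratic part by 4; since the sum of these two
    parts is always 0, so is each of them. *)
Lemma cubic_polarization (V : zmodType) (T : V -> V -> V -> C) :
  (forall x x' y z, T (x + x') y z = T x y z + T x' y z) ->
  (forall x y y' z, T x (y + y') z = T x y z + T x y' z) ->
  (forall x y z, T x y z = T x z y) ->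
  (forall x, T x x x = 0) ->
  forall a y, T y a a + (T a y a + T a a y) = 0.
Proof.
move=> D1 D2 S T0 a y.
have D3 x u v w : T x u (v + w) = T x u v + T x u w.
  by rewrite S D2 ![T _ _ u]S.
pose lin y := T y a a + (T a y a + T a a y).
pose quad y := T a y y + (T y a y + T y y a).
have sum0 u : lin u + quad u = 0.
  have := T0 (a + u); rewrite !(D1, D2, D3) !T0 => <-; rewrite /lin /quad; ring.
have lin2 : lin (y + y) = lin y *+ 2 by rewrite /lin !(D1, D2, D3); ring.
have quad2 : quad (y + y) = quad y *+ 4 by rewrite /quad !(D1, D2, D3); ring.
have h1 := sum0 y; have h2 := sum0 (y + y); rewrite lin2 quad2 in h2.
have : lin y *+ 2 = 0.
  transitivity ((lin y + quad y) *+ 4 - (lin y *+ 2 + quad y *+ 4)); first ring.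
  by rewrite h1 h2 subr0 mul0rn.
by move/eqP; rewrite mulrn_eq0 => /eqP.
Qed.

(** On the line a + t b with t real, the second argument is also a + t b. The
    vanishing then continues to t = 'i, where the two arguments a + 'i b and
    a - 'i b are arbitrary. *)
Lemma hermitian_polarization m (Phi : 'cV[C]_m -> 'cV[C]_m -> C) :
  (forall a b, polyfun (fun t => Phi (a + t *: b) (a + t^* *: b))) ->
  (forall a, Phi a a = 0) -> forall z zeta, Phi z zeta = 0.
Proof.
move=> pPhi Phi0 z zeta.
(* The solution of a + 'i b = z and a - 'i b = zeta. *)
pose a := 2^-1 *: (z + zeta); pose b := (2 * 'i)^-1 *: (z - zeta).
have i0 : 'i != 0 :> C by exact: neq0Ci.
have := polyfun_eq0 (pPhi a b) _ 'i; rewrite conjCi.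
have -> : a + 'i *: b = z.
  by apply/colP => l; rewrite !mxE; field.
have -> : a + (- 'i) *: b = zeta.
  by apply/colP => l; rewrite !mxE; field.
by apply=> n; rewrite conjC_nat Phi0.
Qed.

End Polarization.

(** * The bilinear map of a T-nondegenerate form *)

Section Core.
Variables (R : realType) (m k : nat).
Notation C := (cplx R).
Variable A : 'I_k -> 'M[C]_m.
Notation F := (hform A).
Notation cj := (map_mx Num.conj).
Hypothesis hA : forall j, A j \is hermsymmx.
Hypothesis hT : T_nondegenerate A.

Variable M : 'I_m -> 'M[C]_k.
Hypothesis M_sym : forall l, (M l)^T = M l.
Definition qmap (N : 'I_m -> 'M[C]_k) (u v : 'cV[C]_k) : 'cV[C]_m :=
  \col_l qform (N l) u v.
Notation K := (qmap M).

Lemma qmapE u v l : K u v l 0 = qform (M l) u v.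
Proof. by rewrite mxE. Qed.

Lemma qmapC u v : K u v = K v u.
Proof.
apply/colP => l; rewrite !qmapE /qform exchange_big.
apply: eq_bigr => i _; apply: eq_bigr => j _.
by rewrite -{1}M_sym mxE; ring.
Qed.

Lemma qmapDl u u' v : K (u + u') v = K u v + K u' v.
Proof.
apply/colP => l; rewrite [RHS]mxE !qmapE /qform -big_split /=.
apply: eq_bigr => i _; rewrite -big_split /=; apply: eq_bigr => j _.
by rewrite mxE; ring.
Qed.

Lemma qmapDr u v v' : K u (v + v') = K u v + K u v'.
Proof. by rewrite qmapC qmapDl ![K _ u]qmapC. Qed.

Lemma qmapZl c u v : K (c *: u) v = c *: K u v.
Proof.
apply/colP => l; rewrite [RHS]mxE !qmapE /qform mulr_sumr.
apply: eq_bigr => i _; rewrite mulr_sumr; apply: eq_bigr => j _.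
by rewrite mxE; ring.
Qed.

Lemma qmapZr c u v : K u (c *: v) = c *: K u v.
Proof. by rewrite qmapC qmapZl qmapC. Qed.

Lemma qmapNl u v : K (- u) v = - K u v.
Proof. by rewrite -scaleN1r qmapZl scaleN1r. Qed.

Lemma qmapNr u v : K u (- v) = - K u v.
Proof. by rewrite qmapC qmapNl qmapC. Qed.

Lemma hform_eq0C a b : F a b = 0 -> F b a = 0.
Proof. by move=> h; rewrite -hform_conj // h map_mx0. Qed.

Definition T_generic a := form_orth A (form_T A a) = [set 0].

Lemma T_generic_eq0 a x :
  T_generic a -> (forall y, form_T A a y -> F x y = 0) -> x = 0.
Proof. by move=> Ta h; have : form_orth A (form_T A a) x by []; rewrite Ta. Qed.

Lemma T_generic_continuous_eq0 (phi : 'cV[C]_m -> C) :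
  continuous phi -> (forall a, T_generic a -> phi a = 0) -> forall a, phi a = 0.
Proof.
have [_ [U [_ dU sU]]] := hT.
by move=> cphi h; apply: dense_eq0 dU cphi _ => a /sU; exact: h.
Qed.

Section Cubic.
Hypothesis cubic0 : forall z zeta, F z (K (F zeta z) (F zeta z)) = 0.

Definition bilinE := (hformDl, hformDr, qmapDl, qmapDr).

(** The conjugate of zeta is an independent variable, of degree two in
    [cubic0]. *)
Lemma cubic_polar z zeta eta : F z (K (F zeta z) (F eta z)) = 0.
Proof.
apply/colP => j; rewrite [RHS]mxE.
move: zeta eta; apply: symmetric_alternating0.
- by move=> x y w; rewrite !bilinE mxE.
- by move=> x y; rewrite qmapC.
- by move=> x; rewrite cubic0 mxE.
Qed.

(** Polarize [cubic0] at z = zeta = a in direction y in T(a). Where y occurs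
    inside K it does so as F(a, y) = F(- x, a), and these terms vanish by
    [cubic_polar]. So F(y, K(s, s)) = 0 with s = F(a, a). *)
Lemma qmap_diag0 a : T_generic a -> K (F a a) (F a a) = 0.
Proof.
move=> Ta; apply: T_generic_eq0 Ta _ => y [x xy].
apply: hform_eq0C; apply/colP => j; rewrite [RHS]mxE.
have Fay : F a y = F (- x) a.
  by rewrite hformNl; apply/eqP; rewrite -addr_eq0 addrC xy.
have := @cubic_polarization C _
  (fun z z1 z2 => F z (K (F a z1) (F a z2)) j 0) _ _ _ _ a y.
rewrite Fay [K (F a a) (F (- x) a)]qmapC cubic_polar !mxE !addr0; apply.
- by move=> *; rewrite !bilinE mxE.
- by move=> *; rewrite !bilinE mxE.
- by move=> *; rewrite qmapC.
- by move=> z; rewrite cubic0 mxE.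
Qed.

Lemma polyfun_hform_line a b j :
  polyfun (fun t : C => F (a + t *: b) (a + t^* *: b) j 0).
Proof.
apply: polyfun_hform => l; first exact: polyfun_line.
exact: polyfun_conj (polyfun_line a b l).
Qed.

(** Holding for generic a, the identity [qmap_diag0] holds for all a by
    continuity, and then polarizes. *)
Lemma qmap_square0 z zeta : K (F z zeta) (F z zeta) = 0.
Proof.
apply/colP => l; rewrite [RHS]mxE.
move: z zeta; apply: hermitian_polarization => [a b|].
  have [p hp] : polyfun (fun t : C => qform (M l)
      (F (a + t *: b) (a + t^* *: b)) (F (a + t *: b) (a + t^* *: b))).
    apply: polyfun_sum => i; apply: polyfun_sum => j.
    apply: polyfunM (polyfun_hform_line _ _ _).
    apply: polyfunM (polyfun_cst _); exact: polyfun_hform_line.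
  by exists p => t; rewrite -hp qmapE.
apply: T_generic_continuous_eq0 => [|a Ta]; last by rewrite qmap_diag0 ?mxE.
rewrite (_ : (fun a => _) = (fun a => qform (M l) (F a a) (F a a))); last first.
  by apply/funext => a; rewrite qmapE.
apply: continuous_bigsum => i; apply: continuous_bigsum => j x.
apply: (@cvgM C _ (nbhs x) _ (fun a => F a a i 0 * M l i j)
  (fun a => F a a j 0)); last exact: continuous_hform_diag.
apply: (@cvgM C _ (nbhs x) _ (fun a => F a a i 0) (fun=> M l i j)).
  exact: continuous_hform_diag.
exact: cvg_cst.
Qed.

Lemma qmap_same_right x y b : K (F x b) (F y b) = 0.
Proof.
apply/colP => l; rewrite [RHS]mxE; move: x y; apply: symmetric_alternating0.
- by move=> *; rewrite !bilinE mxE.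
- by move=> *; rewrite qmapC.
- by move=> x; rewrite qmap_square0 mxE.
Qed.

Lemma qmap_same_left a x y : K (F a x) (F a y) = 0.
Proof.
apply/colP => l; rewrite [RHS]mxE; move: x y; apply: symmetric_alternating0.
- by move=> *; rewrite !bilinE mxE.
- by move=> *; rewrite qmapC.
- by move=> x; rewrite qmap_square0 mxE.
Qed.

Lemma qmap_antisym_right a a' x y :
  K (F a x) (F a' y) = - K (F a y) (F a' x).
Proof.
apply/eqP; rewrite -addr_eq0; apply/eqP/colP => l; rewrite [RHS]mxE.
rewrite [LHS]mxE.
apply: (@alternating_antisym C _ (fun x y => K (F a x) (F a' y) l 0)).
- by move=> *; rewrite !bilinE mxE.
- by move=> *; rewrite !bilinE mxE.
- by move=> z; rewrite qmap_same_right mxE.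
Qed.

Lemma qmap_antisym_left a a' x y :
  K (F a x) (F a' y) = - K (F a' x) (F a y).
Proof. by rewrite qmap_antisym_right qmapC. Qed.

(** Exchanging y with the second argument a brings F(a, y) = - F(x, a) into K;
    the two values of F then share their second argument a. *)
Lemma qmap_form_T a y zeta : form_T A a y -> K (F a a) (F zeta y) = 0.
Proof.
move=> [x xy]; rewrite qmap_antisym_right.
have -> : F a y = - F x a by apply/eqP; rewrite -addr_eq0 addrC xy.
by rewrite qmapNl opprK qmap_same_right.
Qed.

(** The mirror image of [qmap_form_T]: by Hermitian symmetry
    F(y, a) = - F(a, x). *)
Lemma qmap_form_T_left a y z : form_T A a y -> K (F a a) (F y z) = 0.
Proof.
move=> [x xy]; rewrite qmap_antisym_left.
have -> : F y a = - F a x.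
  rewrite -hform_conj // -[F a x]hform_conj // -map_mxN; congr (map_mx _ _).
  by apply/eqP; rewrite -addr_eq0 addrC xy.
by rewrite qmapNl opprK qmap_same_left.
Qed.

Variable q : 'cV[C]_m -> 'cV[C]_k -> 'cV[C]_m.
Hypothesis q_spec : forall z zeta w,
  F (q z w) zeta = (4 * 'i) *: F z (K (cj w) (F zeta z)).

Lemma hform_diag_real a : cj (F a a) = F a a.
Proof. exact: hform_conj. Qed.

(** B is the polarization of q(., F(a, a)) at (z, y). Its pairing with eta
    reduces, by [qmap_form_T], to the term with y outside K; this term vanishes
    for eta in T(a), so B = 0, and then it vanishes for all eta. *)
Lemma qmap_generic0 a z zeta : T_generic a -> K (F a a) (F zeta z) = 0.
Proof.
move=> Ta; apply: T_generic_eq0 (Ta) _ => y Ty; apply: hform_eq0C.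
pose B := q (z + y) (F a a) - q z (F a a) - q y (F a a).
have FB eta : F B eta = (4 * 'i) *: F y (K (F a a) (F eta z)).
  rewrite /B !hformDl !hformNl !q_spec hform_diag_real !bilinE.
  rewrite !(qmap_form_T _ Ty) !hform0r !addr0 scaler0 subr0 scalerDr.
  by rewrite addrAC subrr add0r.
have B0 : B = 0.
  apply: T_generic_eq0 Ta _ => x Tx.
  by rewrite FB qmap_form_T_left // hform0r scaler0.
have := FB zeta; rewrite B0 hform0l => /esym/eqP.
by rewrite scaler_eq0 mulf_eq0 pnatr_eq0 (negbTE (neq0Ci _)) => /eqP.
Qed.

Lemma qmap_eq0 u v : K u v = 0.
Proof.
have [nd _] := hT.
have K1 a b z zeta : K (F a b) (F zeta z) = 0.
  apply/colP => l; rewrite [RHS]mxE.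
  have E w : K w (F zeta z) l 0 =
      \sum_i w i 0 * (\sum_j M l i j * F zeta z j 0).
    rewrite qmapE; apply: eq_bigr => i _; rewrite mulr_sumr.
    by apply: eq_bigr => j _; rewrite mulrA.
  move: a b; apply: hermitian_polarization => [a b|].
    have [p hp] : polyfun (fun t : C => \sum_i
        F (a + t *: b) (a + t^* *: b) i 0 * (\sum_j M l i j * F zeta z j 0)).
      apply: polyfun_sum => i.
      by apply: polyfunM (polyfun_cst _); exact: polyfun_hform_line.
    by exists p => t; rewrite -hp E.
  apply: T_generic_continuous_eq0 => [|a Ta]; last first.
    by rewrite qmap_generic0 ?mxE.
  rewrite (_ : (fun a => _) =
    (fun a => \sum_i F a a i 0 * (\sum_j M l i j * F zeta z j 0))); last first.
    by apply/funext => a; rewrite E.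
  apply: continuous_bigsum => i x.
  apply: (@cvgM C _ (nbhs x) _ (fun a => F a a i 0)
    (fun=> \sum_j M l i j * F zeta z j 0)); last exact: cvg_cst.
  exact: continuous_hform_diag.
have M0 l i j : M l i j = 0.
  move: j; apply: (nondegenerate_span nd) => zeta z.
  move: i; apply: (nondegenerate_span nd) => a b.
  rewrite -[RHS](_ : K (F a b) (F zeta z) l 0 = 0); last by rewrite K1 mxE.
  rewrite qmapE; apply: eq_bigr => i _; rewrite mulr_suml.
  by apply: eq_bigr => j _; ring.
apply/colP => l; rewrite qmapE mxE /qform big1 // => i _.
by rewrite big1 // => j _; rewrite M0 mulr0 mul0r.
Qed.

End Cubic.
End Core.

(** * The equations of an infinitesimal automorphism of degree 3 *)

Section Automorphisms.
Variables (R : realType) (m k : nat).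
Notation C := (cplx R).
Variable A : 'I_k -> 'M[C]_m.
Notation F := (hform A).
Notation cj := (map_mx Num.conj).
Hypothesis hA : forall j, A j \is hermsymmx.

Lemma conj_coord n (u : 'cV[C]_n) i : cj u i 0 = (u i 0)^*.
Proof. by rewrite mxE. Qed.

Lemma hform_conjE a b j : (F a b j 0)^* = F b a j 0.
Proof. by rewrite -(hform_conj a b hA) [RHS]mxE. Qed.

Lemma poly_evalE n (h : 'cV[mpoly (m + k) C]_n) z w l :
  poly_eval h z w l 0 = mev (h l 0) z w.
Proof. by rewrite mxE. Qed.

Lemma polyfun_mev (p : mpoly (m + k) C)
    (z : C -> 'cV[C]_m) (w : C -> 'cV[C]_k) :
  (forall l, polyfun (fun t => z t l 0)) ->
  (forall j, polyfun (fun t => w t j 0)) ->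
  polyfun (fun t => mev p (z t) (w t)).
Proof.
move=> hz hw; apply: polyfun_meval => i.
case: (split_ordP i) => [l ->|j ->].
  by have [q hq] := hz l; exists q => t; rewrite col_mxEu.
by have [q hq] := hw j; exists q => t; rewrite col_mxEd.
Qed.

Variables (f : 'cV[mpoly (m + k) C]_m) (g : 'cV[mpoly (m + k) C]_k).
Notation fe := (poly_eval f).
Notation ge := (poly_eval g).

(** The conjugate of z becomes an independent variable zeta. Along the line
    z = a + t b, u = c1 + t c2 with t real, the equation says that X(t) is real,
    where X is polynomial in t. It continues to t = 'i, where (z, conj z, u)
    becomes an arbitrary complex triple. *)
Lemma quadric_aut_polarized : quadric_aut A f g -> forall z zeta w,
  let w' := cj w + (2 * 'i) *: F zeta z in
  ge z w - (2 * 'i) *: F (fe z w) zeta =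
  cj (ge zeta w') + (2 * 'i) *: F z (fe zeta w').
Proof.
move=> hfg z zeta w w'; apply/colP => j.
(* The solution of a + 'i b = z and a - 'i b = zeta. *)
pose a : 'cV[C]_m := 2^-1 *: (z + zeta).
pose b : 'cV[C]_m := (2 * 'i)^-1 *: (z - zeta).
(* At t = 'i the line c1 + t c2 has to pass through the value of u for which
   w = u + 'i F(z, zeta). *)
have [u1 [u2 uE]] : exists u1 u2 : 'cV[R]_k, forall i,
    w i 0 - 'i * F z zeta i 0 =
      map_mx (real_complex R) u1 i 0 + 'i * map_mx (real_complex R) u2 i 0.
  exists (\col_i complex.Re (w i 0 - 'i * F z zeta i 0)).
  exists (\col_i complex.Im (w i 0 - 'i * F z zeta i 0)) => i.
  by rewrite !mxE; exact: complexE.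
have cR (u : 'cV[R]_k) i :
    ((map_mx (real_complex R) u i 0 : C)^*) = map_mx (real_complex R) u i 0.
  by rewrite mxE; exact: conjc_real.
pose c1 : 'cV[C]_k := map_mx (real_complex R) u1.
pose c2 : 'cV[C]_k := map_mx (real_complex R) u2.
pose zt (t : C) := a + t *: b.
pose W (t : C) := c1 + t *: c2 + 'i *: F (zt t) (zt t^*).
pose X (t : C) :=
  (ge (zt t) (W t) - (2 * 'i) *: F (fe (zt t) (W t)) (zt t^*)) j 0.
have zt_conj l : polyfun (fun t => ((zt t^*) l 0)^*).
  exact: polyfun_conj (polyfun_line a b l).
have pW i : polyfun (fun t => W t i 0).
  have [p hp] := polyfunD (polyfun_line c1 c2 i) (polyfunM (polyfun_cst 'i)
    (polyfun_hform A (polyfun_line a b) zt_conj i)).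
  by exists p => t; rewrite -hp /W coordD [in LHS]coordZ.
have pf l : polyfun (fun t => fe (zt t) (W t) l 0).
  have [p hp] := polyfun_mev (f l 0) (polyfun_line a b) pW.
  by exists p => t; rewrite poly_evalE hp.
have pX : polyfun X.
  have [p hp] := polyfunD (polyfun_mev (g j 0) (polyfun_line a b) pW)
    (polyfunN (polyfunM (polyfun_cst (2 * 'i)) (polyfun_hform A pf zt_conj j))).
  by exists p => t; rewrite -hp /X !coordE poly_evalE.
have conjNi : (- 'i)^* = 'i :> C by rewrite rmorphN /= conjCi opprK.
have i0 : 'i != 0 :> C by exact: neq0Ci.
have zti : zt 'i = z by apply/colP => l; rewrite !mxE; field.
have ztNi : zt (- 'i) = zeta by apply/colP => l; rewrite !mxE; field.
have Wi : W 'i = w.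
  rewrite /W conjCi zti ztNi; apply/colP => i.
  by rewrite !coordE /c1 /c2 -uE subrK.
have WNi : W (- 'i) = w'.
  rewrite /W conjNi zti ztNi /w'.
  apply/colP => i; rewrite [RHS]coordD conj_coord [in RHS]coordZ !coordD !coordZ.
  have := congr1 Num.conj (uE i).
  rewrite rmorphB !(rmorphD, rmorphM) /= !conjCi !cR hform_conjE.
  rewrite -/c1 -/c2; move: (c1 i 0) (c2 i 0) (w i 0)^* (F zeta z i 0).
  move=> x y s t /eqP; rewrite subr_eq => /eqP ->; ring.
have X_real (n : nat) : X n%:R = (X n%:R)^*.
  apply/esym/CrealP/Creal_ImP; rewrite /X conjC_nat.
  have <- : quadric_w A (zt n%:R) (u1 + n%:R *: u2) = W n%:R.
    rewrite /quadric_w /W conjC_nat; congr (_ + _).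
    by apply/colP => i; rewrite !mxE rmorphD rmorphM /= rmorph_nat.
  exact: hfg.
have X_i : X 'i = (X (- 'i))^*.
  rewrite -conjCi; apply/eqP; rewrite -subr_eq0; apply/eqP.
  apply: (polyfun_eq0 (polyfunD pX (polyfunN (polyfun_conj pX)))) => n.
  by rewrite conjC_nat {1}X_real subrr.
rewrite /X conjNi conjCi zti ztNi Wi WNi in X_i.
rewrite X_i [RHS]coordD [in RHS]conj_coord [in RHS]coordZ coordD coordN coordZ.
by rewrite rmorphB rmorphM /= hform_conjE rmorphM /= conjCi rmorph_nat; ring.
Qed.

Hypothesis f_weight :
  forall l mu, mu \in msupp (f l 0) -> mon_weight mu = 4%N.
Hypothesis g_weight :
  forall j mu, mu \in msupp (g j 0) -> mon_weight mu = 5%N.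
Hypothesis hfg : quadric_aut A f g.

(** The polarized equation at zeta = 0; there g(0, .) drops out since its weight
    is odd. *)
Lemma aut3_g z w : ge z w = (2 * 'i) *: F z (fe 0 (cj w)).
Proof.
have g0 v : ge 0 v = 0.
  apply/colP => j; rewrite poly_evalE mxE mev_odd // => mu /g_weight -> //.
have := quadric_aut_polarized hfg z 0 w.
by rewrite /= hform0l scaler0 addr0 hform0r scaler0 subr0 g0 map_mx0 add0r.
Qed.

Lemma conj_shift z zeta w :
  cj (cj w + (2 * 'i) *: F zeta z) = w - (2 * 'i) *: F z zeta.
Proof.
apply/colP => j; rewrite [LHS]conj_coord [in LHS]coordD [in LHS]conj_coord.
rewrite coordZ rmorphD rmorphM /= conjCK hform_conjE rmorphM /= conjCi rmorph_nat.
by rewrite coordD coordN coordZ; ring.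
Qed.

Lemma conj_hformZ c a b : cj (c *: F a b) = c^* *: F b a.
Proof. by rewrite map_mxZ hform_conj. Qed.

Lemma cancel_2i (x y s t : 'cV[C]_k) :
  (2 * 'i) *: x - (2 * 'i) *: y = (2 * 'i)^* *: s + (2 * 'i) *: t ->
  x + s = y + t.
Proof.
have i0 : 2 * 'i != 0 :> C by rewrite mulf_neq0 ?pnatr_eq0 ?neq0Ci.
have -> : (2 * 'i)^* = - (2 * 'i) :> C.
  by rewrite rmorphM /= conjCi rmorph_nat mulrN.
rewrite scaleNr [X in _ = X -> _]addrC -!scalerBr.
move=> /(scalerI i0) /eqP; rewrite subr_eq => /eqP ->.
by rewrite addrAC subrK addrC.
Qed.

(** Eliminating g by [aut3_g] leaves an equation for f alone. *)
Lemma aut3_f z zeta w :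
  F z (fe 0 (cj w)) + F (fe 0 (w - (2 * 'i) *: F z zeta)) zeta =
  F (fe z w) zeta + F z (fe zeta (cj w + (2 * 'i) *: F zeta z)).
Proof.
apply: cancel_2i; have := quadric_aut_polarized hfg z zeta w.
by rewrite /= !aut3_g conj_shift conj_hformZ.
Qed.

Variable M : 'I_m -> 'M[C]_k.
Hypothesis M_sym : forall l, (M l)^T = M l.
Notation K := (qmap M).
Hypothesis f0E : forall w, fe 0 w = K w w.

(** The part of [aut3_f] linear in zeta. The term f(zeta, .) - f(0, .) does not
    contribute, being of order two in zeta by [mev_even_line]. To isolate the
    linear part, zeta is scaled by a natural number n, which commutes with
    conjugation. *)
Lemma aut3_linear z zeta w :
  F (fe z w - fe 0 w) zeta = (4 * 'i) *: F z (K (cj w) (F zeta z)).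
Proof.
have [w1 w1E] : exists w1, w1 = (2 * 'i) *: F zeta z by eexists.
have [y yE] : exists y, y = (2 * 'i) *: F z zeta by eexists.
have /choice [r hr] : forall l, exists r, polyfun r /\ forall t,
    mev (f l 0) (t *: zeta) (cj w + t *: w1) =
    mev (f l 0) 0 (cj w + t *: w1) + t ^+ 2 * r t.
  move=> l; have [|r pr hr] := @mev_even_line C m k (f l 0) zeta (cj w) w1.
    by move=> mu /f_weight ->.
  by exists r.
pose rv t : 'cV[C]_m := \col_l r l t.
have feE t : fe (t *: zeta) (cj w + t *: w1) =
    K (cj w + t *: w1) (cj w + t *: w1) + t ^+ 2 *: rv t.
  apply/colP => l; rewrite poly_evalE (hr l).2 coordD coordZ -f0E poly_evalE.
  by rewrite [rv t l 0]mxE.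
suff E : F (fe z w - fe 0 w) zeta + 2 *: F z (K (cj w) w1) = 0.
  have := E; rewrite w1E (qmapZr M_sym) hformZr rmorphM /= conjCi rmorph_nat.
  move/eqP; rewrite addr_eq0 => /eqP ->.
  by rewrite scalerA -scaleNr; congr (_ *: _); ring.
apply/colP => j; rewrite [RHS]mxE.
(* All the terms of order at least two in n, divided by n ^ 2. *)
pose rho t := - 2 * F (K w y) zeta j 0 + t * F (K y y) zeta j 0 -
  F z (K w1 w1) j 0 - F z (rv t^*) j 0.
apply: (@polyfun_order2 C _ rho) => [|n].
  apply: polyfunD; last first.
    apply: polyfunN; apply: polyfun_hform => l; first exact: polyfun_cst.
    have [p hp] := polyfun_conj (hr l).1.
    by exists p => t; rewrite -hp mxE.
  apply: polyfunD; last exact: polyfun_cst.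
  apply: polyfunD; first exact: polyfun_cst.
  by apply: polyfunM; [exact: polyfun_id | exact: polyfun_cst].
have nC : (n%:R : C)^* = n%:R by exact: conjC_nat.
have e1 : (2 * 'i) *: (n%:R *: F zeta z) = n%:R *: w1.
  by rewrite w1E !scalerA mulrC.
have e2 : (2 * 'i) *: (n%:R *: F z zeta) = n%:R *: y.
  by rewrite yE !scalerA mulrC.
have := aut3_f z (n%:R *: zeta) w.
rewrite hformZl !hformZr nC e1 e2 feE !f0E /rho nC.
generalize (fe z w) (cj w) => f1 cw.
rewrite !(qmapDl, qmapDr M_sym, qmapNl, qmapNr M_sym, qmapZl, qmapZr M_sym).
rewrite (qmapC M_sym y w) (qmapC M_sym w1 cw).
generalize (K cw cw) (K cw w1) (K w1 w1) (rv n%:R) (K w w) (K w y) (K y y).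
move=> a1 a2 a3 a4 b1 b2 b3.
rewrite !(hformDl, hformDr, hformNl, hformNr, hformZl, hformZr) rmorphXn /= nC.
generalize (F z a1) (F z a2) (F z a3) (F z a4) (F b1 zeta) (F b2 zeta)
  (F b3 zeta) (F f1 zeta) => x1 x2 x3 x4 y1 y2 y3 y0.
move=> /colP /(_ j); rewrite !coordE => /eqP; rewrite -subr_eq0 => /eqP h.
apply/eqP; rewrite -subr_eq0 -oppr_eq0 -[X in _ == X]h; apply/eqP; ring.
Qed.

(** Given [aut3_linear], what is left of [aut3_f] at w = 0 equates a term of
    bidegree (3, 2) in (z, conj zeta) with one of bidegree (2, 3); replacing zeta by
    2 zeta multiplies them by 4 and by 8. *)
Lemma aut3_cubic z zeta : F z (K (F zeta z) (F zeta z)) = 0.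
Proof.
have K00 : K 0 0 = 0 by rewrite -{1}(scale0r 0) qmapZl scale0r.
have reflect_eq eta :
    F z (K (F eta z) (F eta z)) = - F (K (F z eta) (F z eta)) eta.
  have f_z0 : F (fe z 0) eta = 0.
    have := aut3_linear z eta 0; rewrite f0E K00 subr0 => ->.
    by rewrite map_mx0 -{1}(scale0r 0) qmapZl scale0r hform0r scaler0.
  have f_eta w : F z (fe eta w) =
      (4 * 'i)^* *: F (K (cj w) (F z eta)) eta + F z (K w w).
    rewrite -[fe eta w](subrK (fe 0 w)) hformDr f0E; congr (_ + _).
    by rewrite -hform_conj // -f0E aut3_linear conj_hformZ.
  have := aut3_f z eta 0.
  rewrite f_z0 map_mx0 !add0r f_eta !f0E K00 hform0r add0r.
  rewrite conj_hformZ (qmapNl, qmapNr M_sym) (qmapNl, qmapNr M_sym) opprK.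
  rewrite !(qmapZl, qmapZr M_sym, hformZl, hformZr) !scalerA.
  generalize (F z (K (F eta z) (F eta z))) (F (K (F z eta) (F z eta)) eta).
  move=> x y /colP h; apply/colP => j; move: (h j); rewrite !coordE.
  rewrite !rmorphM /= !conjCi !rmorph_nat; move: (x j 0) (y j 0) => s t.
  have i2 : 'i * 'i = -1 :> C by rewrite -expr2 sqrCi.
  have -> : 2 * 'i * (2 * 'i) * t = - 4 * t.
    by transitivity (4 * ('i * 'i) * t); [ring | rewrite i2; ring].
  have -> : 4 * - 'i * (2 * - 'i) * t = - 8 * t.
    by transitivity (8 * ('i * 'i) * t); [ring | rewrite i2; ring].
  have -> : 2 * - 'i * (2 * - 'i) * s = - 4 * s.
    by transitivity (4 * ('i * 'i) * s); [ring | rewrite i2; ring].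
  move=> e; apply: (mulfI (_ : 4 != 0 :> C)); first by rewrite pnatr_eq0.
  by transitivity (- 8 * t - (- 8 * t + - 4 * s)); [ring | rewrite -e; ring].
have := reflect_eq (2 *: zeta); rewrite hformZl hformZr rmorph_nat.
rewrite !(qmapZl, qmapZr M_sym, hformZl, hformZr) rmorph_nat.
move: (reflect_eq zeta) => /eqP; rewrite -subr_eq0 opprK => /eqP.
generalize (F z (K (F zeta z) (F zeta z))) (F (K (F z zeta) (F z zeta)) zeta).
move=> x y /colP h1 /colP h2; apply/colP => j.
move: (h1 j) (h2 j); rewrite !coordE [(0 : 'cV_k) j 0]mxE.
move: (x j 0) (y j 0) => s t e1 e2.
apply: (mulfI (_ : 4 != 0 :> C)); first by rewrite pnatr_eq0.
transitivity (8 * (s + t) - (2 * (2 * s) + 2 * (2 * (2 * t)))); first ring.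
by rewrite e1 e2; ring.
Qed.

End Automorphisms.

(** * Vanishing of the degree 3 component *)

Lemma poly_eval_eq0 (R : realType) m k n
    (h : 'cV[mpoly (m + k) (cplx R)]_n) :
  (forall z w, poly_eval h z w = 0) -> h = 0.
Proof.
move=> h0; apply/colP => l; rewrite [RHS]mxE; apply: meval_eq0 => v.
have /colP /(_ l) := h0 (\col_i v (lshift k i)) (\col_j v (rshift m j)).
rewrite poly_evalE mxE => <-; apply: meval_eq => i.
by case: (split_ordP i) => j ->; rewrite ?col_mxEu ?col_mxEd mxE.
Qed.

Theorem theorem5p2 (R : realType) (m k : nat) (A : 'I_k -> 'M[cplx R]_m)
    (hA : forall j, A j \is hermsymmx) (hT : T_nondegenerate A) :
  aut_comp A 3 = [set 0].
Proof.
apply/seteqP; split => [[f g]|_ ->]; last first.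
  split=> [l|j|z u j] /=.
  - by move=> mu; rewrite mxE msupp0.
  - by move=> mu; rewrite mxE msupp0.
  - have ev0 n z' w' : poly_eval (0 : 'cV[mpoly (m + k) (cplx R)]_n) z' w' = 0.
      by apply/colP => l; rewrite !mxE meval0.
    by rewrite !ev0 hform0l scaler0 subr0 mxE; apply/Creal_ImP; exact: real0.
move=> [/= wf wg hfg].
have f_weight l mu : mu \in msupp (f l 0) -> mon_weight mu = 4%N.
  by move=> /(wf l) [].
have g_weight j mu : mu \in msupp (g j 0) -> mon_weight mu = 5%N.
  by move=> /(wg j) [].
have /choice [M hM] : forall l, exists N : 'M[cplx R]_k,
    N^T = N /\ forall w, mev (f l 0) 0 w = qform N w w.
  by move=> l; have [N N_sym hN] := mev_weight4 (f_weight l); exists N.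
have M_sym l : (M l)^T = M l := (hM l).1.
have f0E w : poly_eval f 0 w = qmap M w w.
  by apply/colP => l; rewrite poly_evalE qmapE (hM l).2.
have linear := aut3_linear hA f_weight g_weight hfg M_sym f0E.
have cubic := aut3_cubic hA f_weight g_weight hfg M_sym f0E.
have K0 := qmap_eq0 hA hT M_sym cubic linear.
have f0 : f = 0.
  apply: poly_eval_eq0 => z w.
  have [[_ nd] _] := hT; apply: nd => zeta; apply: (hform_eq0C hA).
  have := linear z zeta w; rewrite f0E !K0 subr0 => ->.
  by rewrite hform0r scaler0.
have g0 : g = 0.
  apply: poly_eval_eq0 => z w.
  by rewrite (aut3_g hA g_weight hfg) f0E K0 hform0r scaler0.
by rewrite f0 g0.
Qed.
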